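(* Let $p$ be a prime, $n\ge1$, and let $\sigma\in\mathcal{B}_n(\mathbb{F}_p)$ be of maximal orbit. Then there exist a unique $\varphi\in\mathcal{B}_n(\mathbb{F}_p)$ in standard form, and a diagonal linear map $D$, such that $D^{-1}\varphi^{-1}\sigma\varphi D=\Delta$. (That is: there is exactly one $\varphi\in\mathcal{B}_n(\mathbb{F}_p)$ in standard form for which some invertible diagonal linear map $D$ satisfies this identity.)
   Context: $R_j:=\mathbb{F}_p[X_1,\ldots,X_j]/(X_1^p-X_1,\ldots,X_j^p-X_j)=\mathbb{F}_p[x_1,\ldots,x_j]$ is identified with the ring of functions $\mathbb{F}_p^j\to\mathbb{F}_p$ ($R_0=\mathbb{F}_p$). $\mathcal{B}_n(\mathbb{F}_p)$ is the group (under composition) of all permutations of $\mathbb{F}_p^n$ of the form $\sigma=(x_1+g_1,\ldots,x_n+g_n)$ with $g_i\in R_{i-1}$ for $1\le i\le n$. Such $\sigma$ is of maximal orbit if it consists of one permutation cycle of length $p^n$. An element $\varphi\in\mathcal{B}_n(\mathbb{F}_p)$ is in standard form if $\varphi(0,0,\ldots,0)=(1,0,\ldots,0)$. A diagonal linear map is a map $D=(d_1x_1,\ldots,d_nx_n)$ with $d_i\in\mathbb{F}_p^*$. For $i\ge1$, $\delta_i\in R_i$ is the polynomial function with $\delta_i(p-1,\ldots,p-1)=1$ and $\delta_i(\alpha)=0$ for all other $\alpha\in\mathbb{F}_p^i$, and $\delta_0=1$. Define $\Delta:=(x_1+\delta_0,x_2+\delta_1,\ldots,x_n+\delta_{n-1})\in\mathcal{B}_n(\mathbb{F}_p)$.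 *)

(* Defs.v *)
From mathcomp Require Import all_boot all_algebra all_fingroup.

Set Implicit Arguments.
Unset Strict Implicit.
Unset Printing Implicit Defensive.

Import GRing.Theory.
Local Open Scope ring_scope.

(* R_j = F_p[X_1,...,X_j] / (X_1^p - X_1, ..., X_j^p - X_j), identified with
   the ring of functions F_p^j -> F_p. Points of F_p^j are row vectors. *)
Definition fpfun (p j : nat) := {ffun 'rV['F_p]_j -> 'F_p}.

(* (x_1, ..., x_n) |-> (x_1, ..., x_i). *)
Definition prefix (p n : nat) (i : 'I_n) (x : 'rV['F_p]_n) : 'rV['F_p]_i :=
  \row_(j < i) x 0 (widen_ord (ltnW (ltn_ord i)) j).

(* Indices start at 0: [g i], for i < n, is the function g_{i+1}, which depends
   on the i coordinates x_1, ..., x_i. *)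
Definition triang_fun (p n : nat) (g : forall i : 'I_n, fpfun p i)
    (x : 'rV['F_p]_n) : 'rV['F_p]_n :=
  \row_(i < n) (x 0 i + g i (prefix i x)).

Lemma eq_prefix (p n : nat) (i : 'I_n) (x y : 'rV['F_p]_n) :
  (forall j : 'I_n, (j < i)%N -> x 0 j = y 0 j) -> prefix i x = prefix i y.
Proof. by move=> xy; apply/rowP => j; rewrite !mxE; apply: xy => /=. Qed.

Lemma triang_fun_inj (p n : nat) (g : forall i : 'I_n, fpfun p i) :
  injective (triang_fun g).
Proof.
move=> x y /rowP gxy; apply/rowP => i.
have [m] := ubnP (i : nat); elim: m => // m IHm in i * => /ltnSE le_im.
have := gxy i; rewrite !mxE (@eq_prefix _ _ i x y) => [/addIr //|j lt_ji].
by apply: IHm; apply: leq_trans le_im.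
Qed.

Definition triang (p n : nat) (g : forall i : 'I_n, fpfun p i) :
  {perm 'rV['F_p]_n} := perm (@triang_fun_inj p n g).

Definition B (p n : nat) : {set {perm 'rV['F_p]_n}} :=
  [set s | [exists g : {dffun forall i : 'I_n, fpfun p i}, s == triang g]].

Lemma inBP (p n : nat) (s : {perm 'rV['F_p]_n}) :
  reflect (exists g : forall i : 'I_n, fpfun p i, s = triang g) (s \in B p n).
Proof.
rewrite inE; apply: (iffP existsP) => [[g /eqP->]|[g ->]]; first by exists g.
exists [ffun i => g i]; apply/eqP/permP => x; rewrite !permE.
by apply/rowP => i; rewrite !mxE ffunE.
Qed.

Lemma B_group_set (p n : nat) : group_set (B p n).
Proof.
apply/group_setP; split=> [|_ _ /inBP[g ->] /inBP[h ->]].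
  apply/inBP; exists (fun=> [ffun=> 0]); apply/permP => x; rewrite !permE.
  by apply/rowP => i; rewrite !mxE ffunE addr0.
pose ext (i : 'I_n) (y : 'rV['F_p]_i) : 'rV['F_p]_n :=
  \row_(j < n) if insub (j : nat) is Some k then y 0 k else 0.
have ext_prefix (i : 'I_n) x (j : 'I_n) :
    (j < i)%N -> ext i (prefix i x) 0 j = x 0 j.
  by move=> lt_ji; rewrite mxE insubT mxE; congr (x 0 _); apply: val_inj.
apply/inBP; exists (fun i =>
  [ffun y => g i y + h i (prefix i (triang_fun g (ext i y)))]).
apply/permP => x; rewrite permM !permE; apply/rowP => i; rewrite !mxE ffunE.
rewrite addrA; congr (_ + h i _); apply: eq_prefix => j lt_ji.
rewrite [LHS]mxE [RHS]mxE ext_prefix //; congr (_ + g j _).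
apply: eq_prefix => k lt_kj; rewrite ext_prefix //; exact: ltn_trans lt_ji.
Qed.

Canonical B_group (p n : nat) := Group (B_group_set p n).

Definition maximal_orbit (p n : nat) (s : {perm 'rV['F_p]_n}) : Prop :=
  exists2 C, porbits s = [set C] & #|C| = (p ^ n)%N.

Definition standard_form (p n : nat) (phi : {perm 'rV['F_p]_n}) : Prop :=
  phi 0 = \row_(i < n) ((i : nat) == 0%N)%:R.

Definition diagonal (p n : nat) (D : {perm 'rV['F_p]_n}) : Prop :=
  exists2 d : 'I_n -> 'F_p, (forall i, d i != 0) &
    forall x, D x = \row_(i < n) (d i * x 0 i).

(* For j = 0 the space 'rV_0 is a single point, so this is the constant 1. *)
Definition delta (p j : nat) : fpfun p j :=
  [ffun a => (a == const_mx (p.-1)%:R)%:R].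

Definition Delta (p n : nat) : {perm 'rV['F_p]_n} :=
  triang (fun i : 'I_n => delta p i).

(* Main.v *)
(** The coordinate [i] of a triangular permutation [x |-> x + g x] grows by the
    sum [c i] of all values of [g i] each time the first [i] coordinates run
    once through their cycle. Hence the permutation is transitive iff all [c i]
    are nonzero, and then points of an orbit agree on the first [i] coordinates
    iff their times are congruent modulo [p ^ i]. For two such permutations [t]
    and [s], the map [psi : t^k 0 |-> s^k b] conjugates [t] to [s], and on a
    fibre of the first [i] coordinates its coordinate [i] is affine with slope
    the quotient of the sums of [s] and [t]; so [psi] is a diagonal map followed
    by an element of [B]. Conversely the conjugation equation and the value at
    [0] determine [psi] by transitivity of [Delta], and the slopes of [psi]
    determine its diagonal part. *)
Require Import Defs.
From mathcomp Require Import all_boot all_algebra all_fingroup.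

Set Implicit Arguments.
Unset Strict Implicit.
Unset Printing Implicit Defensive.

Import GRing.Theory.
Local Open Scope ring_scope.

(** Stands in for equality of [prefix]es: it avoids row vectors whose type depends on [i], and it
    allows [i = n], where it becomes equality of points. *)
Definition agree (p n i : nat) (x y : 'rV['F_p]_n) : bool :=
  [forall j : 'I_n, (j < i)%N ==> (x 0 j == y 0 j)].

Lemma agreeP (p n i : nat) (x y : 'rV['F_p]_n) :
  reflect (forall j : 'I_n, (j < i)%N -> x 0 j = y 0 j) (agree i x y).
Proof.
apply: (iffP forallP) => xy j; first by move=> ji; apply/eqP/(implyP (xy j)).
by apply/implyP => /xy ->.
Qed.

Lemma agree_sym (p n i : nat) (x y : 'rV['F_p]_n) : agree i x y = agree i y x.
Proof. by apply: eq_forallb => j; rewrite eq_sym. Qed.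

Lemma agree_full (p n : nat) (x y : 'rV['F_p]_n) : agree n x y = (x == y).
Proof.
apply/agreeP/eqP => [xy|-> //]; apply/rowP => j; exact: xy.
Qed.

Lemma agreeS (p n : nat) (i : 'I_n) (x y : 'rV['F_p]_n) :
  agree i.+1 x y = agree i x y && (x 0 i == y 0 i).
Proof.
apply/agreeP/andP => [xy|[/agreeP xy /eqP xyi] j].
  by split; [apply/agreeP => j /ltnW; exact: xy | rewrite xy].
rewrite ltnS leq_eqVlt => /predU1P[/val_inj->//|]; exact: xy.
Qed.

Lemma prefix_eq (p n : nat) (i : 'I_n) (x y : 'rV['F_p]_n) :
  (Defs.prefix i x == Defs.prefix i y) = agree i x y.
Proof.
apply/eqP/agreeP => [/rowP xy j ji|]; last exact: eq_prefix.
have := xy (Ordinal ji); rewrite !mxE.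
by have -> : widen_ord (ltnW (ltn_ord i)) (Ordinal ji) = j by apply: val_inj.
Qed.

Lemma in_B_agree (p n : nat) (s : {perm 'rV['F_p]_n}) :
  s \in B p n <-> forall (i : 'I_n) x y, agree i x y ->
    s x 0 i - x 0 i = s y 0 i - y 0 i.
Proof.
split=> [/inBP[g ->] i x y|sP].
  by rewrite -prefix_eq !permE !mxE => /eqP->; rewrite !(addrC _ (g i _)) !addrK.
(* The increment depends only on the prefix, so it can be read off at any point above [y]. At
   [prefix i x] the default 0 does not occur, since [x] itself qualifies. *)
pose g (i : 'I_n) : fpfun p i := [ffun y =>
  if [pick x | Defs.prefix i x == y] is Some x then s x 0 i - x 0 i else 0].
apply/inBP; exists g; apply/permP => x; rewrite permE; apply/rowP => i.
rewrite !mxE ffunE; case: pickP => [y|/(_ x)]; last by rewrite eqxx.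
by rewrite prefix_eq => /sP->; rewrite addrC subrK.
Qed.

Lemma iter_triang (p n : nat) (g : forall i : 'I_n, fpfun p i) k x (i : 'I_n) :
  iter k (triang g) x 0 i =
    x 0 i + \sum_(j < k) g i (Defs.prefix i (iter j (triang g) x)).
Proof.
elim: k => [|k IH]; first by rewrite big_ord0 addr0.
by rewrite big_ord_recr /= addrA -IH permE mxE.
Qed.

Definition times_mod (p n i : nat) (s : {perm 'rV['F_p]_n}) : Prop :=
  forall x k, agree i (iter k s x) x = (p ^ i %| k)%N.

Lemma times_mod_eq (p n i : nat) (s : {perm 'rV['F_p]_n}) x k l :
  times_mod i s -> agree i (iter k s x) (iter l s x) = (k == l %[mod p ^ i]).
Proof.
move=> sP; wlog le_lk : k l / (l <= k)%N.
  move=> IH; case: (leqP l k) => [|/ltnW] /IH // H.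
  by rewrite agree_sym H eq_sym.
by rewrite eqn_mod_dvd // -(sP (iter l s x)) -iterD subnK.
Qed.

(** In [p ^ i] consecutive steps the prefixes are pairwise distinct, hence by counting run through
    all of F_p^i once; the increments of coordinate [i] then add up to the full sum of [g i]. *)
Lemma iter_period (p n : nat) (g : forall i : 'I_n, fpfun p i) (i : 'I_n) m x :
  prime p -> times_mod i (triang g) ->
  iter (m * p ^ i) (triang g) x 0 i = x 0 i + (\sum_y g i y) *+ m.
Proof.
move=> p_pr sP; elim: m x => [|m IH] x; first by rewrite addr0.
rewrite mulSn addnC iterD IH mulrS addrA; congr (_ + _).
rewrite iter_triang; congr (_ + _).
pose f (j : 'I_(p ^ i)) := Defs.prefix i (iter j (triang g) x).
have f_inj : injective f.
  move=> j k /eqP; rewrite prefix_eq times_mod_eq // !modn_small //.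
  by move=> /eqP/val_inj.
have f_bij : bijective f.
  by apply: inj_card_bij => //; rewrite card_mx card_Fp // mul1n card_ord.
by rewrite (reindex f) //; apply: onW_bij.
Qed.

Lemma mulrn_Fp_eq0 (p : nat) (c : 'F_p) m :
  prime p -> c != 0 -> (c *+ m == 0) = (p %| m)%N.
Proof.
move=> p_pr c0; rewrite -mulr_natr mulf_eq0 (negPf c0) /=.
by rewrite -(dvdn_pcharf (pchar_Fp p_pr)).
Qed.

(** Induction on [i]: agreement on the first [i] coordinates means [k = m * p ^ i], and coordinate
    [i] has then moved by [m] times a nonzero constant, which vanishes iff [p] divides [m]. *)
Lemma times_mod_triang (p n i : nat) (g : forall i : 'I_n, fpfun p i) :
  prime p -> (i <= n)%N ->
  (forall j : 'I_n, (j < i)%N -> \sum_y g j y != 0) -> times_mod i (triang g).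
Proof.
move=> p_pr; elim: i => [|i IH] lt_in g0 x k.
  by rewrite dvd1n; apply/agreeP.
have sP : times_mod i (triang g) by apply: IH (ltnW lt_in) _ => j /ltnW/g0.
rewrite (agreeS (Ordinal lt_in)) sP; apply/andP/idP => [[/dvdnP[m ->]]|].
  rewrite (@iter_period _ _ _ (Ordinal lt_in)) // -subr_eq0 addrC addKr.
  by rewrite mulrn_Fp_eq0 ?g0 //= expnS dvdn_pmul2r // expn_gt0 prime_gt0.
case/dvdnP => m ->; rewrite expnS mulnA dvdn_mull //; split=> //.
rewrite (@iter_period _ _ _ (Ordinal lt_in)) // -subr_eq0 addrC addKr.
by rewrite mulrn_Fp_eq0 ?g0 //= dvdn_mull.
Qed.

Lemma transitive_sum_neq0 (p n : nat) (g : forall i : 'I_n, fpfun p i) :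
  prime p -> (forall x y, exists k, y = iter k (triang g) x) ->
  forall i : 'I_n, \sum_y g i y != 0.
Proof.
move=> p_pr tr i; have [m] := ubnP (i : nat).
elim: m => // m IH in i * => /ltnSE le_im.
have sP : times_mod i (triang g).
  apply: times_mod_triang => // [|j ji]; first exact: ltnW.
  by apply: IH; apply: leq_trans le_im.
(* The unit vector agrees with 0 before coordinate [i], so it is reached after a multiple of [p ^ i]
   steps. With a zero sum, coordinate [i] would still be 0 then, not 1. *)
apply/eqP => g0; have [k dk] := tr 0 (delta_mx 0 i).
have : agree i (iter k (triang g) 0) 0.
  rewrite -dk; apply/agreeP => j ji; rewrite !mxE eqxx /=.
  by case: eqP ji => // ->; rewrite ltnn.
rewrite sP => /dvdnP[q dq]; move/rowP/(_ i): dk.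
rewrite dq iter_period // g0 mul0rn !mxE !eqxx addr0 => /eqP.
by rewrite oner_eq0.
Qed.

Lemma times_mod_transitive (p n : nat) (s : {perm 'rV['F_p]_n}) x y :
  prime p -> times_mod n s -> exists k, y = iter k s x.
Proof.
move=> p_pr sP; pose f (j : 'I_(p ^ n)) := iter j s x.
have f_inj : injective f.
  move=> j k /eqP; rewrite -agree_full times_mod_eq // !modn_small //.
  by move=> /eqP/val_inj.
have [|h _ hK] := inj_card_bij f_inj.
  by rewrite card_mx card_Fp // mul1n card_ord.
by exists (h y); rewrite -/(f _) hK.
Qed.

Lemma maximal_orbit_transitive (p n : nat) (s : {perm 'rV['F_p]_n}) :
  maximal_orbit s -> forall x y, exists k, y = iter k s x.
Proof.
case=> C sC _ x y.
have porbC z : porbit s z = C by apply/set1P; rewrite -sC imset_f.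
have : y \in porbit s x by rewrite porbC -(porbC y) porbit_id.
by case/porbitP => k ->; exists k; rewrite permX.
Qed.

Lemma sum_delta (p j : nat) : \sum_y delta p j y = 1.
Proof.
rewrite (bigD1 (const_mx (p.-1)%:R)) //= ffunE eqxx big1 ?addr0 // => y.
by rewrite ffunE => /negPf->.
Qed.

Lemma times_mod_Delta (p n : nat) : prime p -> times_mod n (Delta p n).
Proof.
by move=> p_pr; apply: times_mod_triang => // j _; rewrite sum_delta oner_eq0.
Qed.

Lemma iter_conj (T : Type) (s t f : T -> T) k x :
  (forall y, s (f y) = f (t y)) -> iter k s (f x) = f (iter k t x).
Proof. by move=> sf; elim: k => //= k ->. Qed.

Lemma conj_exists (p n : nat) (g h : forall i : 'I_n, fpfun p i) a b :
  prime p -> (forall i : 'I_n, \sum_y g i y != 0) ->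
  (forall i : 'I_n, \sum_y h i y != 0) ->
  exists psi : {perm 'rV['F_p]_n},
    [/\ psi a = b, forall x, triang g (psi x) = psi (triang h x) &
      forall (i : 'I_n) x y, agree i x y ->
        psi y 0 i - psi x 0 i =
          (\sum_z g i z) / (\sum_z h i z) * (y 0 i - x 0 i)].
Proof.
move=> p_pr g0 h0; set s := triang g; set t := triang h.
have sP i : (i <= n)%N -> times_mod i s by move=> le; apply: times_mod_triang.
have tP i : (i <= n)%N -> times_mod i t by move=> le; apply: times_mod_triang.
have tr x : exists k, x == iter k t a.
  by have [k ->] := times_mod_transitive a x p_pr (tP n (leqnn n)); exists k.
pose kappa x := ex_minn (tr x).
have kappaK x : iter (kappa x) t a = x.
  by rewrite /kappa; case: ex_minnP => k /eqP.
(* Both sides mean that [k] and [l] are congruent modulo [p ^ n], so the choice of the time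
   [kappa x] does not affect [psi]. *)
have st k l : (iter k s b == iter l s b) = (iter k t a == iter l t a).
  by rewrite -!agree_full !times_mod_eq //; [apply: tP | apply: sP].
have f_inj : injective (fun x => iter (kappa x) s b).
  by move=> x y /eqP; rewrite st !kappaK => /eqP.
pose psi := perm f_inj.
have psiE k : psi (iter k t a) = iter k s b.
  by rewrite permE; apply/eqP; rewrite st kappaK.
exists psi; split=> [|x|i x y]; first exact: (psiE 0%N).
  by rewrite -[x]kappaK psiE -!iterS psiE.
rewrite -[x]kappaK -[y]kappaK !psiE.
move: (kappa x) (kappa y) => k l; wlog le_kl : k l / (k <= l)%N.
  move=> IH; case: (leqP k l) => [|/ltnW] /IH // H.
  by rewrite agree_sym => /H/(congr1 -%R); rewrite -mulrN !opprB.
rewrite agree_sym times_mod_eq; last exact/tP/ltnW.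
rewrite eqn_mod_dvd // => /dvdnP[m dm].
(* The last [m * p ^ i] steps add [m] times the sum of [h i] to coordinate [i] of the argument and
   [m] times the sum of [g i] to that of its image. *)
rewrite -(subnK le_kl) dm !iterD !iter_period //;
  try by [apply/sP/ltnW | apply/tP/ltnW].
by rewrite !(addrC _ (_ *+ m)) !addrK mulrnAr divfK.
Qed.

Lemma standard_conj_exists (p n : nat) (g h : forall i : 'I_n, fpfun p i) b :
  prime p -> (forall i : 'I_n, \sum_y g i y != 0) ->
  (forall i : 'I_n, \sum_y h i y != 0) ->
  exists phi D : {perm 'rV['F_p]_n}, [/\ phi \in B p n, phi 0 = b, diagonal D &
    forall x, triang g (phi (D x)) = phi (D (triang h x))].
Proof.
move=> p_pr g0 h0.
have [psi [psi0 psiC psiA]] := conj_exists 0 b p_pr g0 h0.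
pose d i := (\sum_z g i z) / (\sum_z h i z).
have d0 i : d i != 0 by rewrite mulf_neq0 ?invr_eq0.
pose fD (x : 'rV['F_p]_n) : 'rV['F_p]_n := \row_i (d i * x 0 i).
have fD_inj : injective fD.
  move=> x y /rowP xy; apply/rowP => i; have := xy i; rewrite !mxE.
  exact: mulfI.
pose D := perm fD_inj; have DE x : D x = fD x by rewrite permE.
have D0 : D 0 = 0 by rewrite DE; apply/rowP => i; rewrite !mxE mulr0.
(* The product applies [D^-1] first. This divides the slope of [psi] on coordinate [i] by [d i], and
   slope 1 is the criterion [in_B_agree]. *)
exists (D^-1 * psi)%g, D; split.
- apply/in_B_agree => i x y; rewrite -[x](permKV D) -[y](permKV D).
  move: ((D^-1)%g x) ((D^-1)%g y) => {}x {}y; rewrite !permM !permK => xy.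
  have {}xy : agree i x y.
    apply/agreeP => j ji; move/agreeP/(_ j ji): xy.
    by rewrite !DE !mxE; apply: mulfI.
  have := psiA i x y xy; rewrite -/(d i) mulrBr => /eqP.
  rewrite subr_eq addrC => /eqP->; rewrite !DE !mxE.
  by rewrite [d i * _ - _]addrC addrA addrK.
- by rewrite permM -{1}D0 permK.
- by exists d => // x; rewrite DE.
- by move=> x; rewrite !permM !permK.
Qed.

Lemma standard_conj_unique (p n : nat) (s t phi phi' D D' : {perm 'rV['F_p]_n}) :
  (forall x, exists k, x = iter k t 0) ->
  phi \in B p n -> phi' \in B p n -> diagonal D -> diagonal D' ->
  phi 0 = phi' 0 -> (forall x, s (phi (D x)) = phi (D (t x))) ->
  (forall x, s (phi' (D' x)) = phi' (D' (t x))) -> phi = phi'.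
Proof.
move=> tr phiB phiB' [d d0 dD] [d' d'0 dD'] phi0 C C'.
have D0 : D 0 = 0 by rewrite dD; apply/rowP => i; rewrite !mxE mulr0.
have D'0 : D' 0 = 0 by rewrite dD'; apply/rowP => i; rewrite !mxE mulr0.
(* Both composites send [iter k t 0] to [iter k s (phi 0)], and such points exhaust the space. *)
have psiE x : phi (D x) = phi' (D' x).
  have [k ->] := tr x; have := iter_conj (f := phi' \o D') k 0 C'.
  have := iter_conj (f := phi \o D) k 0 C.
  by rewrite /= D0 D'0 phi0 => -> ->.
have dE i : d i = d' i.
  pose e : 'rV['F_p]_n := delta_mx 0 i.
  have ag (c : 'I_n -> 'F_p) : agree i (\row_j (c j * e 0 j)) 0.
    apply/agreeP => j ji; rewrite !mxE eqxx /=.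
    by case: eqP ji => [->|_ _]; rewrite ?ltnn ?mulr0.
  (* Passing from 0 to [e] raises coordinate [i] of the common composite by [d i], and equally by
     [d' i]. *)
  have /in_B_agree/(_ i _ _ (ag d)) := phiB.
  have /in_B_agree/(_ i _ _ (ag d')) := phiB'.
  rewrite -dD -dD' -psiE phi0 => <- /addrI/oppr_inj.
  by rewrite dD dD' !mxE !eqxx !mulr1.
have DE : D = D'.
  by apply/permP => x; rewrite dD dD'; apply/rowP => i; rewrite !mxE dE.
by apply/permP => x; rewrite -[x](permKV D) psiE DE.
Qed.

Theorem theorem2p15 (p n : nat) (sigma : {perm 'rV['F_p]_n}) :
  prime p -> (0 < n)%N -> sigma \in B p n -> maximal_orbit sigma ->
  exists! phi : {perm 'rV['F_p]_n},
    [/\ phi \in B p n, standard_form phi &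
      exists2 D : {perm 'rV['F_p]_n}, diagonal D &
        D^-1%g \o phi^-1%g \o sigma \o phi \o D =1 Delta p n].
Proof.
move=> p_pr _ /inBP[g ->] /maximal_orbit_transitive tr.
have g0 := transitive_sum_neq0 p_pr tr.
have h0 (i : 'I_n) : \sum_y delta p i y != 0 by rewrite sum_delta oner_eq0.
have [phi [D [phiB phi0 dD C]]] :=
  standard_conj_exists (\row_(i < n) ((i : nat) == 0%N)%:R) p_pr g0 h0.
exists phi; split=> [|phi' [phiB' phi0' [D' dD' C']]].
  by split=> //; exists D => // x /=; rewrite C !permK.
apply: (standard_conj_unique _ phiB phiB' dD dD' _ C) => [x||x].
- exact/times_mod_transitive/times_mod_Delta.
- by rewrite phi0 phi0'.
- by rewrite -[triang _ x]C' /= !permKV.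
Qed.
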